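(* Let $\mathcal A$ be a unital complex $*$-algebra and let $\mathcal X$ be a finitely generated projective right $\mathcal A$-module with a strongly non-degenerate inner product $\langle\cdot|\cdot\rangle$. Then there exists a finite set of pairs $\{(x_i,x_i')\}_{i=1}^n\subset\mathcal X\times\mathcal X$ such that $$x=\sum_{i=1}^n x_i\langle x_i'|x\rangle=\sum_{i=1}^n x_i'\langle x_i|x\rangle\qquad\text{for all }x\in\mathcal X.$$
   Context: An inner product on a right $\mathcal A$-module $\mathcal X$ here means a biadditive map $\langle\cdot|\cdot\rangle:\mathcal X\times\mathcal X\to\mathcal A$ with $\langle x|ya\rangle=\langle x|y\rangle a$ and $\langle x|y\rangle^*=\langle y|x\rangle$ (no positivity is assumed). It is strongly non-degenerate if the (conjugate-linear) map $x\mapsto(y\mapsto\langle x|y\rangle)$ is a bijection from $\mathcal X$ onto the set $\overrightarrow{\mathrm{Hom}}_{\mathcal A}(\mathcal X,\mathcal A)$ of right-$\mathcal A$-linear maps $\mathcal X\to\mathcal A$. *)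

(* Defs.v *)
From HB Require Import structures.
From mathcomp Require Import all_boot all_order all_algebra.
From mathcomp Require Import complex.
From mathcomp Require Import classical_sets functions reals.

Set Implicit Arguments.
Unset Strict Implicit.
Unset Printing Implicit Defensive.

Import GRing.Theory Num.Theory.

Local Open Scope ring_scope.
Local Open Scope classical_set_scope.

(* The zero algebra is a legitimate unital algebra, but [algType C] imposes
   [1 != 0]; hence algebras over possibly zero rings, with their own scaling
   operation (HB rejects a structure joining [pzRingType] and [lmodType C] that
   [algType C] does not inherit from). *)
HB.mixin Record PzRing_isPzAlgebra (C : pzRingType) A of GRing.PzRing A := {
  algscale : C -> A -> A;
  algscaleA : forall c d a, algscale c (algscale d a) = algscale (c * d) a;
  algscale1 : forall a, algscale 1 a = a;
  algscaleDr : forall c a b, algscale c (a + b) = algscale c a + algscale c b;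
  algscaleDl : forall a c d, algscale (c + d) a = algscale c a + algscale d a;
  algscaleAl : forall c a b, algscale c (a * b) = algscale c a * b;
  algscaleAr : forall c a b, algscale c (a * b) = a * algscale c b;
}.

#[short(type="pzAlgType")]
HB.structure Definition PzAlgebra (C : pzRingType) :=
  { A of GRing.PzRing A & PzRing_isPzAlgebra C A }.

HB.mixin Record PzAlgebra_isStar (C : numClosedFieldType) A
    of PzAlgebra C A := {
  star : A -> A;
  starK : involutive star;
  starD : forall a b, star (a + b) = star a + star b;
  starZ : forall (c : C) a, star (algscale c a) = algscale (c^*) (star a);
  starM : forall a b, star (a * b) = star b * star a;
}.

#[short(type="starAlgType")]
HB.structure Definition StarAlgebra (C : numClosedFieldType) :=
  { A of PzAlgebra C A & PzAlgebra_isStar C A }.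

(* A right A-module is a left module over the converse ring. *)
Notation rmodType A := (lmodType (A^c)%type).

Definition rscale (A : pzRingType) (X : rmodType A) (x : X) (a : A) : X :=
  (a : A^c) *: x.

Notation "x :* a" := (rscale x a) : ring_scope.

Definition finitely_generated (R : pzRingType) (M : lmodType R) : Prop :=
  exists (n : nat) (e : 'I_n -> M),
    forall x : M, exists c : 'I_n -> R, x = \sum_(i < n) c i *: e i.

Definition projective (R : pzRingType) (P : lmodType R) : Prop :=
  forall (M N : lmodType R) (g : {linear M -> N}) (f : {linear P -> N}),
    (forall y : N, exists x : M, g x = y) ->
    exists h : {linear P -> M}, forall x : P, g (h x) = f x.

Definition right_linear (A : pzRingType) (X : rmodType A) (f : X -> A) : Prop :=
  (forall x y : X, f (x + y) = f x + f y) /\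
  (forall (x : X) (a : A), f (x :* a) = f x * a).

Section InnerProduct.
Variables (C : numClosedFieldType) (A : starAlgType C) (X : rmodType A).

Record inner_product (ip : X -> X -> A) : Prop := InnerProduct {
  ipDl : forall x y z, ip (x + y) z = ip x z + ip y z;
  ipDr : forall x y z, ip x (y + z) = ip x y + ip x z;
  ipZr : forall x y a, ip x (y :* a) = ip x y * a;
  ip_star : forall x y, star (ip x y) = ip y x;
}.

Definition strongly_nondegenerate (ip : X -> X -> A) : Prop :=
  set_bij [set: X] [set f : X -> A | right_linear f] (fun x y => ip x y).

End InnerProduct.

(* Main.v *)
Require Import Defs.
From HB Require Import structures.
From mathcomp Require Import all_boot all_order all_algebra.
From mathcomp Require Import complex.
From mathcomp Require Import boolp classical_sets reals.

(* Projectivity splits a surjection from a free module onto X, which gives a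
   dual basis (u_i, f_i), and strong nondegeneracy writes f_i = <u'_i | _>.
   The expansion with u and u' exchanged is the adjoint of the first one:
   <y | sum_i u'_i <u_i|x>> = <sum_i u_i <u'_i|y> | x> = <y|x> for all y. *)

Set Implicit Arguments.
Unset Strict Implicit.

Import GRing.Theory.

Local Open Scope ring_scope.

Section DualBasis.
Variables (R : pzRingType) (P : lmodType R) (n : nat) (e : 'I_n -> P).

(** Row vectors model the free module of rank [n]; registering the map as linear lets it serve as
    the surjection in [projective]. *)
Definition lincomb (v : 'rV[R]_n) : P := \sum_(i < n) v 0 i *: e i.

Lemma lincomb_is_linear : linear lincomb.
Proof.
move=> a v w; rewrite /lincomb scaler_sumr -big_split /=.
by apply: eq_bigr => i _; rewrite !mxE scalerDl scalerA.
Qed.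

HB.instance Definition _ :=
  GRing.isLinear.Build R 'rV[R]_n P *:%R lincomb lincomb_is_linear.

End DualBasis.

Lemma dual_basis (R : pzRingType) (P : lmodType R) :
  finitely_generated P -> projective P ->
  exists (n : nat) (e : 'I_n -> P) (h : {linear P -> 'rV[R]_n}),
    forall x, x = \sum_(i < n) h x 0 i *: e i.
Proof.
move=> [n [e gen_e]] projP; exists n, e.
have lincomb_surj (y : P) : exists v, lincomb e v = y.
  have [c ->] := gen_e y; exists (\row_i c i).
  by apply: eq_bigr => i _; rewrite mxE.
(* Lifting the identity of [P] along [lincomb e] yields a linear section [h], whose coordinates are
   the dual functionals. *)
have [h hK] := projP _ _ (lincomb e) idfun lincomb_surj.
by exists h => x; rewrite -[LHS]hK.
Qed.

Section InnerProductTheory.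
Variables (C : numClosedFieldType) (A : starAlgType C) (X : rmodType A).
Variables (ip : X -> X -> A) (ip_inner : inner_product ip).

Lemma ipZl x a y : ip (x :* a) y = star a * ip x y.
Proof.
by rewrite -(ip_star ip_inner) (ipZr ip_inner) starM (ip_star ip_inner).
Qed.

Lemma ip0l y : ip 0 y = 0.
Proof. by apply: (addrI (ip 0 y)); rewrite -(ipDl ip_inner) !addr0. Qed.

Lemma ip0r x : ip x 0 = 0.
Proof. by apply: (addrI (ip x 0)); rewrite -(ipDr ip_inner) !addr0. Qed.

Lemma ip_suml n (u : 'I_n -> X) y :
  ip (\sum_(i < n) u i) y = \sum_(i < n) ip (u i) y.
Proof.
exact: (big_morph (ip^~ y) (fun x z => ipDl ip_inner x z y) (ip0l y)).
Qed.

Lemma ip_sumr n x (u : 'I_n -> X) :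
  ip x (\sum_(i < n) u i) = \sum_(i < n) ip x (u i).
Proof. exact: (big_morph (ip x) (ipDr ip_inner x) (ip0r x)). Qed.

(** Both sides expand to the sum of [ip y (u' i) * ip (u i) x]; on the right, the scalar
    [ip (u' i) y] leaves the first slot starred. *)
Lemma ip_expansion_adjoint n (u u' : 'I_n -> X) x y :
  ip y (\sum_(i < n) u' i :* ip (u i) x) =
  ip (\sum_(i < n) u i :* ip (u' i) y) x.
Proof.
rewrite ip_suml ip_sumr; apply: eq_bigr => i _.
by rewrite ipZl (ipZr ip_inner) (ip_star ip_inner).
Qed.

Hypothesis ip_nondeg : strongly_nondegenerate ip.

(** Nondegeneracy gives injectivity in the first slot; the star carries it over to the second. *)
Lemma ip_injr x z : (forall y, ip y x = ip y z) -> x = z.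
Proof.
have [_ inj_ip _] := ip_nondeg => eq_xz.
apply: inj_ip; rewrite ?in_setT //; apply: funext => y.
by rewrite -!(ip_star ip_inner y) eq_xz.
Qed.

Lemma ip_represent f : right_linear f -> exists x, forall y, f y = ip x y.
Proof. by have [_ _ surj_ip] := ip_nondeg => /surj_ip[x _ <-]; exists x. Qed.

End InnerProductTheory.

Theorem lemmaA3 (R : realType) (A : starAlgType R[i]) (X : rmodType A)
    (ip : X -> X -> A) :
  finitely_generated X -> projective X ->
  inner_product ip -> strongly_nondegenerate ip ->
  exists (n : nat) (u u' : 'I_n -> X), forall x : X,
    x = \sum_(i < n) u i :* ip (u' i) x /\
    x = \sum_(i < n) u' i :* ip (u i) x.
Proof.
move=> fgX projX ip_inner ip_nondeg.
have [n [u [h uhE]]] := dual_basis fgX projX.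
have /fin_all_exists[u' u'E] i : exists x, forall y, h y 0 i = ip x y.
  apply: (ip_represent ip_nondeg); split=> [x y|x a].
    by rewrite linearD mxE.
  (* The entries lie in [A^c], where multiplying by [a] on the left is multiplying by [a] on the
     right in [A]. *)
  by rewrite /rscale linearZ mxE.
have uE x : x = \sum_(i < n) u i :* ip (u' i) x.
  by rewrite [LHS]uhE; apply: eq_bigr => i _; rewrite u'E.
exists n, u, u' => x; split; first exact: uE.
apply: (ip_injr ip_inner ip_nondeg) => y.
(* The first expansion, taken at [y], collapses the left slot back to [y]. *)
by rewrite ip_expansion_adjoint // -uE.
Qed.
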